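(* Let $a,b\in\mathbb{R}$ and let $\lambda,\mu>0$ be such that $$(\lambda a)^2+(\mu b)^2=\frac{1-\delta}{2}$$ for some real number $\delta\in[0,1]$. Let $u^0\in\ell^2(\mathbb{Z}^2;\mathbb{R})$ and let the sequences $u^n=(u^n_{j,k})_{(j,k)\in\mathbb{Z}^2}$, $n\in\mathbb{N}$, be defined inductively from $u^0$ by the two-dimensional Lax-Wendroff scheme with stabilizer \begin{align*} u_{j,k}^{n+1} = u_{j,k}^n & - \frac{\lambda a}{2}\big(u_{j+1,k}^n-u_{j-1,k}^n\big) - \frac{\mu b}{2}\big(u_{j,k+1}^n-u_{j,k-1}^n\big)\\ & + \frac{(\lambda a)^2}{2}\big(u_{j+1,k}^n-2u_{j,k}^n+u_{j-1,k}^n\big) + \frac{(\mu b)^2}{2}\big(u_{j,k+1}^n-2u_{j,k}^n+u_{j,k-1}^n\big)\\ & + \frac{\lambda a\,\mu b}{4}\big(u_{j+1,k+1}^n-u_{j+1,k-1}^n-u_{j-1,k+1}^n+u_{j-1,k-1}^n\big)\\ & - \frac{(\lambda a)^2+(\mu b)^2}{8}\big(u_{j+1,k+1}^n-2u_{j+1,k}^n+u_{j+1,k-1}^n-2u_{j,k+1}^n+4u_{j,k}^n-2u_{j,k-1}^n\\ &\qquad\qquad\qquad\qquad +u_{j-1,k+1}^n-2u_{j-1,k}^n+u_{j-1,k-1}^n\big),\qquad (j,k)\in\mathbb{Z}^2 . \end{align*} Then for all $n\in\mathbb{N}$, $$\|u^{n+1}\|_{\ell^2(\mathbb{Z}^2)}^2-\|u^n\|_{\ell^2(\mathbb{Z}^2)}^2\le-\frac{\delta}{4}\Big((\lambda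 a)^2\,\|\Delta_1u^n\|_{\ell^2(\mathbb{Z}^2)}^2+(\mu b)^2\,\|\Delta_2u^n\|_{\ell^2(\mathbb{Z}^2)}^2\Big).$$
   Context: $\mathbb{N}=\{0,1,2,\dots\}$. For $\mathcal{J}\subset\mathbb{Z}^2$, $\ell^2(\mathcal{J};\mathbb{R})$ is the Hilbert space of real square integrable sequences indexed by $\mathcal{J}$, with $\|u\|_{\ell^2(\mathcal{J})}^2=\sum_{(j,k)\in\mathcal{J}}u_{j,k}^2$. The discrete Laplacians are $(\Delta_1U)_{j,k}=U_{j+1,k}-2U_{j,k}+U_{j-1,k}$ and $(\Delta_2U)_{j,k}=U_{j,k+1}-2U_{j,k}+U_{j,k-1}$. In the paper $\lambda=\Delta t/\Delta x$ and $\mu=\Delta t/\Delta y$ are fixed positive ratios of the time step to the space steps. *)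

(* Defs.v *)
From HB Require Import structures.
From mathcomp Require Import all_boot all_order all_algebra.
From mathcomp Require Import all_classical all_reals ereal esum.

Set Implicit Arguments.
Unset Strict Implicit.
Unset Printing Implicit Defensive.

Import Order.TTheory GRing.Theory Num.Theory.

Local Open Scope classical_set_scope.
Local Open Scope ring_scope.

(* Squared l2 norm of the restriction of u to J.  It takes values in \bar R,
   and equals +oo when u is not square summable on J: no default real value is
   ever attached to a divergent sum. *)
Definition l2normsq (R : realType) (J : set (int * int)) (u : int * int -> R)
    : \bar R :=
  \esum_(p in J) (u p ^+ 2)%:E.

Definition l2 (R : realType) (J : set (int * int)) : set (int * int -> R) :=
  [set u | (l2normsq J u < +oo)%E].
Arguments l2 : clear implicits.

Definition Delta1 (R : realType) (U : int * int -> R) : int * int -> R :=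
  fun p => let: (j, k) := p in U (j + 1, k) - 2 * U (j, k) + U (j - 1, k).

Definition Delta2 (R : realType) (U : int * int -> R) : int * int -> R :=
  fun p => let: (j, k) := p in U (j, k + 1) - 2 * U (j, k) + U (j, k - 1).

Definition lax_wendroff_stab (R : realType) (a b lambda mu : R)
    (u : int * int -> R) : int * int -> R :=
  fun p => let: (j, k) := p in
  u (j, k)
  - lambda * a / 2 * (u (j + 1, k) - u (j - 1, k))
  - mu * b / 2 * (u (j, k + 1) - u (j, k - 1))
  + (lambda * a) ^+ 2 / 2 * (u (j + 1, k) - 2 * u (j, k) + u (j - 1, k))
  + (mu * b) ^+ 2 / 2 * (u (j, k + 1) - 2 * u (j, k) + u (j, k - 1))
  + lambda * a * (mu * b) / 4
    * (u (j + 1, k + 1) - u (j + 1, k - 1)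
       - u (j - 1, k + 1) + u (j - 1, k - 1))
  - ((lambda * a) ^+ 2 + (mu * b) ^+ 2) / 8
    * (u (j + 1, k + 1) - 2 * u (j + 1, k) + u (j + 1, k - 1)
       - 2 * u (j, k + 1) + 4 * u (j, k) - 2 * u (j, k - 1)
       + u (j - 1, k + 1) - 2 * u (j - 1, k) + u (j - 1, k - 1)).

(* Main.v *)
(* Write [al = lambda * a], [be = mu * b], [sg = al^2 + be^2], and let
   [X = 1 - cos xi], [Y = 1 - cos eta], [s = sin xi], [t = sin eta].  The symbol
   G of the scheme satisfies
     |G|^2 - 1 = W^2 - al^2 X^2 - be^2 Y^2 - sg X Y,
     W = al^2 X + be^2 Y + al be s t + sg X Y / 2.
   W is the value at [(al, be)] of a quadratic form with matrix M, so Lagrange's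
   identity turns [W^2] into
   [sg |M (al, be)|^2] minus a square.  The difference
   [2 (al^2 X^2 + be^2 Y^2 + sg X Y) - |M (al, be)|^2] is again a sum of squares,
     (X + Y) (al s - be t)^2 / 2 + (al X t - be Y s)^2 / 2
     + (X - Y)^2 (al^2 X + be^2 Y) / 2,
   and [1 - 2 sg = delta] leaves the announced dissipation.  No Fourier transform
   is needed: the squared norm of a finite difference operator applied to u is a
   finite linear combination of the correlations [corr u d], which are even in d,
   so the identity between symbols becomes a linear identity between
   correlations. *)

Require Import Defs.
From HB Require Import structures.
From mathcomp Require Import all_boot all_order all_algebra.
From mathcomp Require Import all_classical all_reals ereal esum.
From mathcomp Require Import ring lra.

Set Implicit Arguments.
Unset Strict Implicit.
Unset Printing Implicit Defensive.

Import Order.TTheory GRing.Theory Num.Theory.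

Local Open Scope classical_set_scope.
Local Open Scope ring_scope.

(** * Absolutely convergent real sums *)

Lemma ge0_esumZl (R : realType) (T : choiceType) (c : R) (f : T -> \bar R) :
  0 <= c -> (forall x, (0 <= f x)%E) ->
  (\esum_(x in [set: T]) (c%:E * f x) = c%:E * \esum_(x in [set: T]) f x)%E.
Proof.
move=> c0 f0; rewrite /esum -ereal_supZl//; last first.
  by apply/set0P; eexists; exists set0 => //; exact: fsets_set0.
rewrite image_comp; congr ereal_sup.
by apply: eq_imagel => A _; rewrite /= ge0_mule_fsumr.
Qed.

(** [fine] would turn an infinite sum into 0, so the passage back to [\bar R] goes through [nsumE],
    restricted to nonnegative summable families. *)
Definition nsum (R : realType) (T : choiceType) (f : T -> R) : R :=
  fine (\esum_(x in [set: T]) (f x)%:E)%E.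

Definition rsummable (R : realType) (T : choiceType) (f : T -> R) : Prop :=
  summable [set: T] (EFin \o f).

(* Meaningful only for [rsummable f], where both terms are finite. *)
Definition rsum (R : realType) (T : choiceType) (f : T -> R) : R :=
  nsum (fun x => `|f x| + f x) - nsum (fun x => `|f x|).

Section RealSums.
Variables (R : realType) (T : choiceType).
Implicit Types f g h : T -> R.

Lemma rsummable_le f g :
  (forall x, `|f x| <= g x) -> rsummable g -> rsummable f.
Proof.
move=> fg; apply: le_lt_trans; apply: le_esum => x _ /=.
by rewrite lee_fin (le_trans (fg x))// ler_norm.
Qed.

Lemma rsummableD f g :
  rsummable f -> rsummable g -> rsummable (fun x => f x + g x).
Proof. by move=> sf sg; exact: (summableD sf sg). Qed.

Lemma rsummable_norm f : rsummable f -> rsummable (fun x => `|f x|).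
Proof.
by apply: le_lt_trans; apply: le_esum => x _ /=; rewrite normr_id.
Qed.

Lemma rsummableZ c f : rsummable f -> rsummable (fun x => c * f x).
Proof.
move=> sf; rewrite /rsummable /summable.
under eq_esum do rewrite /= normrM EFinM.
rewrite ge0_esumZl//.
by apply: lte_mul_pinfty => //; rewrite ?lee_fin.
Qed.

Lemma nsumE f : (forall x, 0 <= f x) -> rsummable f ->
  (\esum_(x in [set: T]) (f x)%:E)%E = (nsum f)%:E.
Proof.
move=> f0 sf; rewrite fineK// ge0_fin_numE; last first.
  by apply: esum_ge0 => x _; rewrite lee_fin.
by apply: le_lt_trans sf; apply: le_esum => x _ /=; rewrite lee_fin ler_norm.
Qed.

Lemma nsumD f g : (forall x, 0 <= f x) -> (forall x, 0 <= g x) ->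
  rsummable f -> rsummable g -> nsum (fun x => f x + g x) = nsum f + nsum g.
Proof.
move=> f0 g0 sf sg; apply: EFin_inj; rewrite EFinD -!nsumE//.
- by rewrite -esumD// => x _; rewrite lee_fin.
- by move=> x; rewrite addr_ge0.
- exact: rsummableD.
Qed.

Lemma nsumZ c f : 0 <= c -> (forall x, 0 <= f x) -> rsummable f ->
  nsum (fun x => c * f x) = c * nsum f.
Proof.
move=> c0 f0 sf; apply: EFin_inj; rewrite EFinM -!nsumE//.
- by rewrite -ge0_esumZl// => x; rewrite lee_fin.
- by move=> x; rewrite mulr_ge0// normrD_ge0.
- exact: rsummableZ.
Qed.

Lemma normrD_ge0 (x : R) : 0 <= `|x| + x.
Proof. by have := ler_norm (- x); rewrite normrN; lra. Qed.

(** From [f = g - h] follows [(|f| + f) + h = |f| + g], where all families are nonnegative and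
    [nsumD] applies. Hence any such splitting of [f] computes [rsum f]. *)
Lemma rsum_diff f g h : (forall x, 0 <= g x) -> (forall x, 0 <= h x) ->
  rsummable g -> rsummable h -> (forall x, f x = g x - h x) ->
  rsum f = nsum g - nsum h.
Proof.
move=> g0 h0 sg sh fE.
have sf : rsummable f.
  apply: (@rsummable_le _ (fun x => g x + h x)); last exact: rsummableD.
  by move=> x; rewrite fE (le_trans (ler_normB _ _))// !ger0_norm.
have sn := rsummable_norm sf.
have := nsumD (fun x => normr_ge0 (f x)) g0 sn sg.
have := nsumD (fun x => normrD_ge0 (f x)) h0 (rsummableD sn sf) sh.
rewrite (_ : (fun x => _ + h x) = (fun x => `|f x| + g x)); last first.
  by apply/funext => x; rewrite fE; ring.
by rewrite /rsum; lra.
Qed.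

Lemma rsummable0 : rsummable (fun _ : T => 0 : R).
Proof. by rewrite /rsummable /summable esum1// => x _ /=; rewrite normr0. Qed.

Lemma rsum_nsum f : (forall x, 0 <= f x) -> rsummable f -> rsum f = nsum f.
Proof.
move=> f0 sf; rewrite (@rsum_diff f f (fun=> 0))//.
- by rewrite /nsum [X in _ - fine X]esum1// subr0.
- exact: rsummable0.
- by move=> x; rewrite subr0.
Qed.

Lemma rsum0 : rsum (fun _ : T => 0 : R) = 0.
Proof.
rewrite /rsum /nsum !esum1 ?subr0//= => x _; rewrite normr0//.
by rewrite addr0.
Qed.

Lemma rsumD f g : rsummable f -> rsummable g ->
  rsum (fun x => f x + g x) = rsum f + rsum g.
Proof.
move=> sf sg; have [nf ng] := (rsummable_norm sf, rsummable_norm sg).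
rewrite (@rsum_diff _ (fun x => (`|f x| + f x) + (`|g x| + g x))
  (fun x => `|f x| + `|g x|)).
- rewrite (nsumD _ _ (rsummableD nf sf) (rsummableD ng sg)) ?(nsumD _ _ nf ng)//.
  + by rewrite /rsum; ring.
  + by move=> x; exact: normrD_ge0.
  + by move=> x; exact: normrD_ge0.
- by move=> x; rewrite addr_ge0// normrD_ge0.
- by move=> x; rewrite addr_ge0.
- by do !apply: rsummableD.
- exact: rsummableD.
- by move=> x; ring.
Qed.

Lemma rsumZ c f : rsummable f -> rsum (fun x => c * f x) = c * rsum f.
Proof.
move=> sf; have nf := rsummable_norm sf.
have pf := rsummableD nf sf.
have [c0|c0] := leP 0 c.
  rewrite (@rsum_diff _ (fun x => c * (`|f x| + f x)) (fun x => c * `|f x|)).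
  - by rewrite !nsumZ// ?/rsum; [ring|move=> x; exact: normrD_ge0].
  - by move=> x; rewrite mulr_ge0// normrD_ge0.
  - by move=> x; rewrite mulr_ge0// normrD_ge0.
  - exact: rsummableZ.
  - exact: rsummableZ.
  - by move=> x; ring.
have Nc0 : 0 <= - c by lra.
(* A negative factor exchanges the two nonnegative parts of [f]. *)
rewrite (@rsum_diff _ (fun x => (- c) * `|f x|) (fun x => (- c) * (`|f x| + f x))).
- by rewrite !nsumZ// ?/rsum; [ring|move=> x; exact: normrD_ge0].
- by move=> x; rewrite mulr_ge0// normrD_ge0.
- by move=> x; rewrite mulr_ge0// normrD_ge0.
- exact: rsummableZ.
- exact: rsummableZ.
- by move=> x; ring.
Qed.

Lemma rsummable_sum (I : Type) (s : seq I) (F : I -> T -> R) :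
  (forall i, rsummable (F i)) -> rsummable (fun x => \sum_(i <- s) F i x).
Proof.
move=> sF; elim: s => [|i s IH].
  by under eq_fun do rewrite big_nil; exact: rsummable0.
by under eq_fun do rewrite big_cons; exact: rsummableD.
Qed.

Lemma rsum_sum (I : Type) (s : seq I) (F : I -> T -> R) :
  (forall i, rsummable (F i)) ->
  rsum (fun x => \sum_(i <- s) F i x) = \sum_(i <- s) rsum (F i).
Proof.
move=> sF; elim: s => [|i s IH].
  by under eq_fun do rewrite big_nil; rewrite big_nil rsum0.
under eq_fun do rewrite big_cons.
by rewrite big_cons rsumD ?IH//; exact: rsummable_sum.
Qed.

Lemma esum_bij (e : T -> T) (f : T -> \bar R) : bijective e ->
  (\esum_(x in [set: T]) f (e x) = \esum_(x in [set: T]) f x)%E.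
Proof.
by move=> be; rewrite [RHS](reindex_esum [set: T] _ e)// setTT_bijective.
Qed.

Lemma rsum_bij (e : T -> T) f : bijective e -> rsum (f \o e) = rsum f.
Proof.
move=> be; rewrite /rsum /nsum.
by rewrite (@esum_bij e (fun x => (`|f x| + f x)%:E))// (@esum_bij e (fun x => `|f x|%:E)).
Qed.

End RealSums.

(** * Correlations and finite difference operators *)

Definition corr (R : realType) (u : int * int -> R) (d : int * int) : R :=
  rsum (fun p => u p * u (p + d)).

Definition stencil (R : realType) (s : seq (R * (int * int)))
    (u : int * int -> R) : int * int -> R :=
  fun p => \sum_(c <- s) c.1 * u (p + c.2).

Section Stencils.
Variable R : realType.
Implicit Types (u : int * int -> R) (d e p : int * int) (s : seq (R * (int * int))).

Lemma bijective_shift d : bijective (fun p => p + d).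
Proof. by exists (fun p => p - d) => p; rewrite (addrK, subrK). Qed.

Lemma rsummable_l2 u : l2 R setT u <-> rsummable (fun p => u p ^+ 2).
Proof.
rewrite /rsummable /summable (eq_esum (b := fun p => (u p ^+ 2)%:E))//.
by move=> p _ /=; rewrite ger0_norm ?sqr_ge0.
Qed.

(** Follows from [|x y| <= x^2 + y^2] and the shift invariance of sums of squares. *)
Lemma rsummable_shiftM u d e : l2 R setT u ->
  rsummable (fun p => u (p + d) * u (p + e)).
Proof.
move=> /rsummable_l2 su.
have sh c : rsummable (fun p => u (p + c) ^+ 2).
  rewrite /rsummable /summable.
  by rewrite (@esum_bij _ _ _ (fun p => `|u p ^+ 2|%:E) (bijective_shift c)).
apply: rsummable_le (rsummableD (sh d) (sh e)) => p.
by rewrite ler_norml; nra.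
Qed.

Lemma rsum_shiftM u d e :
  rsum (fun p => u (p + d) * u (p + e)) = corr u (e - d).
Proof.
rewrite /corr -(rsum_bij (fun p => u p * u (p + (e - d))) (bijective_shift d)).
by congr rsum; apply/funext => p /=; rewrite -addrA [d + _]addrC subrK.
Qed.

Lemma corrN u d : corr u (- d) = corr u d.
Proof.
rewrite -sub0r -rsum_shiftM.
by congr rsum; apply/funext => p; rewrite addr0 mulrC.
Qed.

Lemma stencil_sqr s u p : stencil s u p ^+ 2 =
  \sum_(c <- s) \sum_(c' <- s) c.1 * c'.1 * (u (p + c.2) * u (p + c'.2)).
Proof.
rewrite expr2 /stencil mulr_suml; apply: eq_bigr => c _.
by rewrite mulr_sumr; apply: eq_bigr => c' _; ring.
Qed.

Lemma rsummable_stencil_sqr s u : l2 R setT u ->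
  rsummable (fun p => stencil s u p ^+ 2).
Proof.
move=> su; under eq_fun do rewrite stencil_sqr.
do 2!apply: rsummable_sum => ?.
exact/rsummableZ/rsummable_shiftM.
Qed.

Lemma l2_stencil s u : l2 R setT u -> l2 R setT (stencil s u).
Proof. by move=> su; apply/rsummable_l2/rsummable_stencil_sqr. Qed.

(** For [c d = cos (d . theta)] this is the squared modulus of the symbol of [s]; for [c = corr u]
    with [u] square summable it is the squared norm of [stencil s u]. With [c] abstract, an identity
    between symbols becomes one linear in [c]. *)
Definition energy s (c : int * int -> R) : R :=
  \sum_(a <- s) \sum_(b <- s) a.1 * b.1 * c (b.2 - a.2).

Lemma l2normsq_stencil s u : l2 R setT u ->
  l2normsq setT (stencil s u) = (energy s (corr u))%:E.
Proof.
move=> su; have ss := rsummable_stencil_sqr s su.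
rewrite /l2normsq nsumE//; last by move=> x; rewrite sqr_ge0.
rewrite -rsum_nsum//; last by move=> x; rewrite sqr_ge0.
congr EFin; under [X in rsum X]eq_fun do rewrite stencil_sqr.
rewrite rsum_sum => [|c]; last first.
  by apply: rsummable_sum => ?; exact/rsummableZ/rsummable_shiftM.
apply: eq_bigr => c _; rewrite rsum_sum => [|c']; last first.
  exact/rsummableZ/rsummable_shiftM.
apply: eq_bigr => c' _.
by rewrite rsumZ ?rsum_shiftM//; exact: rsummable_shiftM.
Qed.

Lemma energy_ge0 s u : l2 R setT u -> 0 <= energy s (corr u).
Proof.
move=> su; rewrite -lee_fin -l2normsq_stencil//.
by apply: esum_ge0 => p _; rewrite lee_fin sqr_ge0.
Qed.

Lemma l2normsq_corr0 u : l2 R setT u -> l2normsq setT u = (corr u 0)%:E.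
Proof.
move=> /rsummable_l2 su; rewrite /l2normsq nsumE//; last first.
  by move=> x; rewrite sqr_ge0.
rewrite -rsum_nsum//; last by move=> x; rewrite sqr_ge0.
by congr EFin; congr rsum; apply/funext => p; rewrite addr0 expr2.
Qed.

End Stencils.

(** * Stencils of the scheme and the energy balance *)

Definition stencil_mul (R : realType) (s t : seq (R * (int * int))) :=
  [seq (a.1 * b.1, a.2 + b.2) | a <- s, b <- t].

Definition stencil_scale (R : realType) (k : R) (s : seq (R * (int * int))) :=
  [seq (k * a.1, a.2) | a <- s].

Section LaxWendroff.
Variable R : realType.
Implicit Types (al be : R).

(** The symbol of [fwd1] has squared modulus 2 X, that of [ctr1] is i s, that of [lap1] is -2 X.
    Composing with [fwd1] thus weights a squared symbol by 2 X, with no square root of X. *)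
Definition fwd1 : seq (R * (int * int)) := [:: (1, (1, 0)); (-1, (0, 0))].
Definition fwd2 : seq (R * (int * int)) := [:: (1, (0, 1)); (-1, (0, 0))].
Definition ctr1 : seq (R * (int * int)) := [:: (2^-1, (1, 0)); (- 2^-1, (-1, 0))].
Definition ctr2 : seq (R * (int * int)) := [:: (2^-1, (0, 1)); (- 2^-1, (0, -1))].
Definition lap1 : seq (R * (int * int)) :=
  [:: (1, (1, 0)); (-2, (0, 0)); (1, (-1, 0))].
Definition lap2 : seq (R * (int * int)) :=
  [:: (1, (0, 1)); (-2, (0, 0)); (1, (0, -1))].

Definition lw_stencil al be : seq (R * (int * int)) :=
  (1, (0, 0))
  :: stencil_scale (- al) ctr1 ++ stencil_scale (- be) ctr2
  ++ stencil_scale (al ^+ 2 / 2) lap1 ++ stencil_scale (be ^+ 2 / 2) lap2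
  ++ stencil_scale (al * be) (stencil_mul ctr1 ctr2)
  ++ stencil_scale (- (al ^+ 2 + be ^+ 2) / 8) (stencil_mul lap1 lap2).

(* Up to sign, its symbol is the determinant of [(al, be)] and [M (al, be)]. *)
Definition cross_defect al be : seq (R * (int * int)) :=
  stencil_scale ((al ^+ 2 - be ^+ 2) / 2) (stencil_mul ctr1 ctr2)
  ++ stencil_scale (- (al * be / 2)) lap1 ++ stencil_scale (al * be / 2) lap2.

Definition skew_gradient al be : seq (R * (int * int)) :=
  stencil_scale al ctr1 ++ stencil_scale (- be) ctr2.

Definition skew_third al be : seq (R * (int * int)) :=
  stencil_scale al (stencil_mul lap1 ctr2)
  ++ stencil_scale (- be) (stencil_mul lap2 ctr1).

Definition lap_diff : seq (R * (int * int)) := lap1 ++ stencil_scale (-1) lap2.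

(* Selects one representative in each pair {d, -d}, so that [field] sees equal
   correlations as equal atoms. *)
Definition half_plane (d : int * int) : int * int :=
  if (d.1 < 0) || ((d.1 == 0) && (d.2 < 0)) then - d else d.

Lemma energy_half_plane (s : seq (R * (int * int))) (c : int * int -> R) :
  (forall d, c (- d) = c d) -> energy s c = energy s (c \o half_plane).
Proof.
move=> cN; rewrite /energy; do 2!apply: eq_bigr => ? _.
by rewrite /= /half_plane; case: ifP => _; rewrite ?cN.
Qed.

Ltac expand_energy c cN :=
  rewrite !(energy_half_plane _ cN) /energy unlock;
  cbv beta iota zeta delta [reducebig applybig foldr map cat flatten comp fst snd
    stencil_mul stencil_scale fwd1 fwd2 ctr1 ctr2 lap1 lap2 lw_stencil
    cross_defect skew_gradient skew_third lap_diff];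
  repeat match goal with |- context [c (half_plane ?d)] =>
    let d' := eval vm_compute in (half_plane d) in
    change (c (half_plane d)) with (c d') end.

(** The factors 1/4, 1/8 and 1/16 compensate the squared moduli 2 X of [fwd1] and 4 X^2 of [lap1].
    Both sides are linear in the values of [c], so comparing coefficients on a half plane of lags
    suffices. *)
Lemma energy_balance al be (c : int * int -> R) (cN : forall d, c (- d) = c d) :
  energy (lw_stencil al be) c
  = c 0 - energy (cross_defect al be) c
    - (al ^+ 2 + be ^+ 2) *
      ((energy (stencil_mul fwd1 (skew_gradient al be)) c
        + energy (stencil_mul fwd2 (skew_gradient al be)) c) / 4
       + energy (skew_third al be) c / 8
       + (al ^+ 2 * energy (stencil_mul fwd1 lap_diff) c
          + be ^+ 2 * energy (stencil_mul fwd2 lap_diff) c) / 16)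
    - (1 - 2 * (al ^+ 2 + be ^+ 2)) / 4
      * (al ^+ 2 * energy lap1 c + be ^+ 2 * energy lap2 c
         + (al ^+ 2 + be ^+ 2) * energy (stencil_mul fwd1 fwd2) c).
Proof. by expand_energy c cN; change (c 0) with (c (0%Z, 0%Z)); field. Qed.

Ltac expand_stencil u j k :=
  rewrite /stencil unlock;
  cbv beta iota zeta delta [reducebig applybig foldr map cat flatten comp fst snd
    stencil_mul stencil_scale ctr1 ctr2 lap1 lap2 lw_stencil];
  (* Computed offsets are turned back into the notation of the scheme; [Negz 0] is -1. *)
  let coord z := lazymatch z with
    | Posz 0 => constr:(0 : int)
    | Posz 1 => constr:(1 : int)
    | Negz 0 => constr:(- 1 : int) end in
  repeat match goal with |- context [u ((j, k) + ?d)] =>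
    lazymatch eval vm_compute in d with (?z1, ?z2) =>
      let x := coord z1 in let y := coord z2 in
      change (u ((j, k) + d)) with (u (j + x, k + y)) end end;
  rewrite ?addr0.

Lemma lax_wendroff_stabE a b lambda mu (u : int * int -> R) :
  lax_wendroff_stab a b lambda mu u
  = stencil (lw_stencil (lambda * a) (mu * b)) u.
Proof.
apply/funext => -[j k]; rewrite /lax_wendroff_stab.
by expand_stencil u j k; field.
Qed.

Lemma Delta1E (u : int * int -> R) : Delta1 u = stencil lap1 u.
Proof.
by apply/funext => -[j k]; rewrite /Delta1; expand_stencil u j k; ring.
Qed.

Lemma Delta2E (u : int * int -> R) : Delta2 u = stencil lap2 u.
Proof.
by apply/funext => -[j k]; rewrite /Delta2; expand_stencil u j k; ring.
Qed.

End LaxWendroff.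

Theorem corollary2p4 (R : realType) (a b lambda mu delta : R)
    (hlambda : 0 < lambda) (hmu : 0 < mu)
    (hdelta : 0 <= delta <= 1)
    (hCFL : (lambda * a) ^+ 2 + (mu * b) ^+ 2 = (1 - delta) / 2)
    (u : nat -> int * int -> R)
    (hu0 : l2 R setT (u 0%N))
    (hu : forall (n : nat) (j k : int),
        u n.+1 (j, k) = lax_wendroff_stab a b lambda mu (u n) (j, k)) :
  forall n : nat,
    (l2normsq setT (u n.+1) - l2normsq setT (u n)
     <= - ((delta / 4)%:E
           * (((lambda * a) ^+ 2)%:E * l2normsq setT (Delta1 (u n))
              + ((mu * b) ^+ 2)%:E * l2normsq setT (Delta2 (u n)))))%E.
Proof.
set al := lambda * a in hCFL *; set be := mu * b in hCFL *.
have uS n : u n.+1 = stencil (lw_stencil al be) (u n).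
  by rewrite -lax_wendroff_stabE; apply/funext => -[j k]; exact: hu.
(* Square summability propagates in time, so all norms are finite and the inequality reduces to one
   in [R]. *)
have ul2 n : l2 R setT (u n).
  by elim: n => // n IH; rewrite uS; exact: l2_stencil.
move=> n; have ul := ul2 n.
rewrite uS Delta1E Delta2E !l2normsq_stencil// l2normsq_corr0//.
rewrite -!EFinM -EFinB -EFinN lee_fin.
rewrite energy_balance; last exact: corrN.
have pos s := energy_ge0 s ul.
set sg := al ^+ 2 + be ^+ 2 in hCFL *.
have sg0 : 0 <= sg by rewrite addr_ge0 ?sqr_ge0.
have -> : 1 - 2 * sg = delta by rewrite hCFL; lra.
have /andP[d0 _] := hdelta.
have := mulr_ge0 (mulr_ge0 d0 sg0) (pos (stencil_mul (fwd1 R) (fwd2 R))).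
have := pos (cross_defect al be).
set E1 := energy (stencil_mul (fwd1 R) (skew_gradient al be)) _.
set E2 := energy (stencil_mul (fwd2 R) (skew_gradient al be)) _.
set E3 := energy (skew_third al be) _.
set E4 := energy (stencil_mul (fwd1 R) (lap_diff R)) _.
set E5 := energy (stencil_mul (fwd2 R) (lap_diff R)) _.
(* The sum of squares in the bracket of [energy_balance], also subtracted there. *)
have dissip : 0 <= sg * ((E1 + E2) / 4 + E3 / 8
    + (al ^+ 2 * E4 + be ^+ 2 * E5) / 16).
  have [e1 e2 e3 e4 e5] : [/\ 0 <= E1, 0 <= E2, 0 <= E3, 0 <= E4 & 0 <= E5].
    by split; exact: pos.
  apply: mulr_ge0 => //.
  have := mulr_ge0 (sqr_ge0 al) e4; have := mulr_ge0 (sqr_ge0 be) e5.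
  by lra.
by move: dissip; lra.
Qed.
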